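(* Let $A:\mathbb Z\to\mathrm M(2,\mathbb C)$ be a bounded sequence such that $\inf_{j\in\mathbb Z}\|A(j)\|>0$. If there exist $\alpha>\alpha'>0$ such that $A(j)\cdot(\mathbb D_\alpha)\subset\mathbb D_{\alpha'}$ for all $j\in\mathbb Z$, then $A$ admits dominated splitting.
   Context: $\mathrm M(2,\mathbb C)$ is the set of complex $2\times2$ matrices, $\mathbb Z_+$ the positive integers, and $\mathbb D_r=\{z\in\mathbb C:|z|<r\}\subset\mathbb C\mathbb P^1=\mathbb C\cup\{\infty\}$. Projective action: a point $z\in\mathbb C$ is identified with the line $\mathrm{span}\{\binom1z\}\subset\mathbb C^2$ and $\infty$ with $\mathrm{span}\{\binom01\}$. A nonzero matrix $A=\begin{pmatrix}a&b\\c&d\end{pmatrix}$ acts by mapping a line to its image, $A\cdot z=\frac{c+dz}{a+bz}$, defined for all $z\in\mathbb C\mathbb P^1$ except the point corresponding to $\ker A$ when $A$ is singular. The condition $A\cdot(\mathbb D_\alpha)\subset\mathbb D_{\alpha'}$ includes the requirement that $A\cdot z$ is defined for every $z\in\mathbb D_\alpha$. For $B:\mathbb Z\to \mathrm M(2,\mathbb C)$ and $n\ge1$ put $B_n(j)=B(j+n-1)\cdots B(j)$. For one-dimensional subspaces $V,W$ of $\mathbb C^2$ put $d(V,W)=\frac{2|\det(\vec v,\vec w)|}{\|\vec v\|\,\|\vec w\|}$ for any nonzero $\vec v\in V$, $\vec w\in W$. Definition. A sequence $B\in\ell^\infty(\mathbb Z,\mathrm M(2,\mathbb C))$ admits dominated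 splitting if for each $j\in\mathbb Z$ there are one-dimensional subspaces $E^u(j),E^s(j)$ of $\mathbb C^2$ such that: (1) $B(j)[E^u(j)]\subseteq E^u(j+1)$ and $B(j)[E^s(j)]\subseteq E^s(j+1)$ for all $j\in\mathbb Z$; (2) there exist $N\in\mathbb Z_+$ and $\lambda>1$ such that $\|B_N(j)\vec u\|>\lambda\|B_N(j)\vec s\|$ for all $j\in\mathbb Z$ and all unit vectors $\vec u\in E^u(j)$, $\vec s\in E^s(j)$; (3) there exists $\delta>0$ such that $d(E^u(j),E^s(j))>\delta$ for all $j\in\mathbb Z$; (4) for the $N$ of condition (2), $\inf_{j\in\mathbb Z}\|B_N(j)\|>0$. *)

(* Defs.v *)
From HB Require Import structures.
From mathcomp Require Import all_boot all_order all_algebra.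
From mathcomp Require Import complex.
From mathcomp Require Import boolp classical_sets reals.

Set Implicit Arguments.
Unset Strict Implicit.
Unset Printing Implicit Defensive.

Import Order.TTheory GRing.Theory Num.Theory.
Local Open Scope classical_set_scope.
Local Open Scope ring_scope.
Local Open Scope complex_scope.

(* R-valued modulus; `|z| itself lives in R[i]. *)
Notation cabs z := (ComplexField.Normc.normc z).

Definition vnorm (R : realType) (v : 'cV[R[i]]_2) : R :=
  Num.sqrt (\sum_(i < 2) cabs (v i 0) ^+ 2).

Definition opnorm (R : realType) (A : 'M[R[i]]_2) : R :=
  sup [set vnorm (A *m v) | v in [set v : 'cV[R[i]]_2 | vnorm v = 1]].

(* None is the point at infinity. *)
Definition CP1 (R : realType) : Type := option R[i].

Definition cp1_vect (R : realType) (p : CP1 R) : 'cV[R[i]]_2 :=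
  if p is Some z then \col_(i < 2) (if i == 0 then 1 else z)
  else \col_(i < 2) (if i == 0 then 0 else 1).

Definition cp1_line (R : realType) (p : CP1 R) : {vspace 'cV[R[i]]_2} :=
  <[cp1_vect p]>%VS.

(* "A . p is defined and equal to q". When A kills the line of p, its image is
   the zero space, so the relation holds for no q; hence it holds for no p and q
   when A = 0. See proj_actE for the formula in the affine chart. *)
Definition proj_act (R : realType) (A : 'M[R[i]]_2) (p q : CP1 R) : Prop :=
  (linfun (mulmx A) @: cp1_line p)%VS = cp1_line q.

Definition proj_sub (R : realType) (A : 'M[R[i]]_2) (D D' : set (CP1 R)) : Prop :=
  forall p, D p -> exists2 q, D' q & proj_act A p q.

Definition disk (R : realType) (r : R) : set (CP1 R) :=
  Some @` [set z : R[i] | cabs z < r].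

Fixpoint iter_mx (R : realType) (B : int -> 'M[R[i]]_2) (n : nat) (j : int) :
    'M[R[i]]_2 :=
  if n is m.+1 then B (j + m%:Z) *m iter_mx B m j else 1%:M.

Definition vect_dist (R : realType) (v w : 'cV[R[i]]_2) : R :=
  2 * cabs (\det (row_mx v w)) / (vnorm v * vnorm w).

(* vpick V is a nonzero vector of V if V is not zero; line_distE shows that the
   choice does not matter. *)
Definition line_dist (R : realType) (V W : {vspace 'cV[R[i]]_2}) : R :=
  vect_dist (vpick V) (vpick W).

(* The ambient requirement that B be bounded is not part of this predicate. *)
Definition dominated_splitting (R : realType) (B : int -> 'M[R[i]]_2) : Prop :=
  exists Eu Es : int -> {vspace 'cV[R[i]]_2},
    [/\ forall j, \dim (Eu j) = 1%N /\ \dim (Es j) = 1%N,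
        forall j, (linfun (mulmx (B j)) @: Eu j <= Eu (j + 1)%R)%VS /\
                  (linfun (mulmx (B j)) @: Es j <= Es (j + 1)%R)%VS,
        exists (N : nat) (lambda : R),
          [/\ (0 < N)%N, 1 < lambda,
              forall j u s, u \in Eu j -> s \in Es j ->
                vnorm u = 1 -> vnorm s = 1 ->
                vnorm (iter_mx B N j *m u) > lambda * vnorm (iter_mx B N j *m s)
            & 0 < inf (range (fun j : int => opnorm (iter_mx B N j)))]
      & exists2 delta : R, 0 < delta & forall j, line_dist (Eu j) (Es j) > delta].

Lemma cabsM (R : realType) (x y : R[i]) : cabs (x * y) = cabs x * cabs y.
Proof. exact: ComplexField.Normc.normcM. Qed.

Lemma vnormZ (R : realType) (a : R[i]) (v : 'cV[R[i]]_2) :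
  vnorm (a *: v) = cabs a * vnorm v.
Proof.
have a0 : 0 <= cabs a by case: a => x y; exact: sqrtr_ge0.
rewrite /vnorm -[in RHS](ger0_norm a0) -sqrtr_sqr -sqrtrM ?sqr_ge0// mulr_sumr.
by congr Num.sqrt; apply: eq_bigr => i _; rewrite mxE cabsM exprMn.
Qed.

Lemma det2 (R : realType) (v w : 'cV[R[i]]_2) :
  \det (row_mx v w) = v 0 0 * w 1 0 - v 1 0 * w 0 0.
Proof.
have det_mx22 (M : 'M[R[i]]_2) : \det M = M 0 0 * M 1 1 - M 1 0 * M 0 1.
  rewrite (expand_det_row _ 0) big_ord_recl big_ord1 /cofactor !det_mx11 !mxE.
  rewrite /= expr0 expr1 mul1r mulN1r mulrN [X in _ - X]mulrC.
  by congr (M _ _ * M _ _ - M _ _ * M _ _); apply: val_inj.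
rewrite det_mx22.
have E0 i : row_mx v w i 0 = v i 0.
  by rewrite (_ : 0 = lshift 1 0 :> 'I_(1 + 1)) ?row_mxEl//; apply: val_inj.
have E1 i : row_mx v w i 1 = w i 0.
  by rewrite (_ : 1 = rshift 1 0 :> 'I_(1 + 1)) ?row_mxEr//; apply: val_inj.
by rewrite !E0 !E1.
Qed.

Lemma line_distE (R : realType) (V W : {vspace 'cV[R[i]]_2}) v w :
  \dim V = 1%N -> \dim W = 1%N -> v \in V -> w \in W -> v != 0 -> w != 0 ->
  line_dist V W = vect_dist v w.
Proof.
have pk (U : {vspace 'cV[R[i]]_2}) u : \dim U = 1%N -> u \in U -> u != 0 ->
    exists2 a, a != 0 & vpick U = a *: u.
  move=> dU uU u0; have UE : U = <[u]>%VS.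
    by apply/eqP; rewrite eq_sym eqEdim -memvE uU dU dim_vline u0.
  have /vlineP[a ua] : vpick U \in <[u]>%VS by rewrite -UE memv_pick.
  exists a => //; apply/eqP => a0; have : vpick U != 0.
    by rewrite vpick0 -dimv_eq0 dU.
  by rewrite ua a0 scale0r eqxx.
move=> dV dW vV wW v0 w0; rewrite /line_dist /vect_dist.
have [a a0 ->] := pk V v dV vV v0; have [b b0 ->] := pk W w dW wW w0.
have c0 x : x != 0 -> cabs x != 0 :> R.
  by apply: contraNneq => /ComplexField.Normc.eq0_normc ->.
have -> : \det (row_mx (a *: v) (b *: w)) = a * b * \det (row_mx v w).
  by rewrite !det2 !mxE mulrBr !mulrA -!(mulrAC _ b) -(mulrA a) (mulrC b).
rewrite !vnormZ !cabsM [X in _ / X]mulrACA [2 * _]mulrCA -mulf_div.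
by rewrite divff ?mul1r// mulf_neq0 ?c0.
Qed.

Lemma cp1_act (R : realType) (A : 'M[R[i]]_2) (z : R[i]) :
  A *m cp1_vect (Some z) =
  \col_i (if i == 0 then A 0 0 + A 0 1 * z else A 1 0 + A 1 1 * z).
Proof.
apply/matrixP => i k; rewrite !mxE big_ord_recl big_ord1 !mxE /= mulr1.
have -> : lift ord0 ord0 = 1 :> 'I_2 by apply: val_inj.
by case: i => -[|[|//]] ?; congr (A _ _ + A _ _ * _); apply: val_inj.
Qed.

Lemma proj_actE (R : realType) (A : 'M[R[i]]_2) (z w : R[i]) :
  proj_act A (Some z) (Some w) <->
  A 0 0 + A 0 1 * z != 0 /\ w = (A 1 0 + A 1 1 * z) / (A 0 0 + A 0 1 * z).
Proof.
rewrite /proj_act /cp1_line limg_line lfunE /=.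
rewrite [A *m _](cp1_act A z).
set c := A 0 0 + _; set d := A 1 0 + _.
set u := \col_i _; set t := \col_i _; split.
  move=> E; have /vlineP[k kE] : t \in <[u]>%VS by rewrite E memv_line.
  have k1 := congr1 (fun v : 'cV_2 => v 0 0) kE.
  have kw := congr1 (fun v : 'cV_2 => v 1 0) kE.
  move: k1 kw; rewrite !mxE /= => k1 ->; have c0 : c != 0.
    by apply/eqP => c0; move/eqP: k1; rewrite c0 mulr0 oner_eq0.
  by split=> //; apply: (mulIf c0); rewrite divfK// mulrAC -k1 mul1r.
move=> [c0 wE]; have -> : u = c *: t.
  apply/matrixP => i k; rewrite !mxE wE; case: ifP => _; first by rewrite mulr1.
  by rewrite mulrC divfK.
apply/eqP; rewrite eqEsubv -!memvE; apply/andP; split.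
  by apply: memvZ; rewrite memv_line.
by apply/vlineP; exists c^-1; rewrite scalerA mulVf// scale1r.
Qed.

(* Main.v *)
Require Import Defs.
From mathcomp Require Import all_boot all_order all_algebra.
From mathcomp Require Import complex ring lra zify.
From mathcomp Require Import boolp classical_sets reals topology normedtype sequences.

Set Implicit Arguments.
Unset Strict Implicit.
Unset Printing Implicit Defensive.

Import Order.TTheory GRing.Theory Num.Theory.
Import numFieldNormedType.Exports.
Local Open Scope classical_set_scope.
Local Open Scope ring_scope.
Local Open Scope complex_scope.

(* The slopes [z j] of the unstable lines and the opposite inverse slopes [q j]
   of the stable ones are bi-infinite orbits of the projective action of [A j],
   respectively of its transpose in reversed time; they exist by compactness of
   a product of intervals. Both actions preserve a closed disk: a covector
   whose kernel avoids the disk of radius [alpha'] is pulled back to one whose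
   kernel avoids the disk of radius [alpha]. In the lemmas [beta] is [alpha'].
   In the invariant frame [(1, z j)], [(- q j, 1)] the matrix [A j] is diagonal,
   with entries [mu j] and [nu j]. Let [Omega r j] be the set of [t] such that
   [(1, z j) + t (- q j, 1)] has slope of modulus less than [r]. Then
   [nu j / mu j] maps [Omega alpha j] into [Omega alpha' (j + 1)], which is
   bounded and remains inside [Omega alpha (j + 1)] after a dilation by a
   uniform factor [1 / rate > 1]. Iterating, the ratio of the products of [nu]
   and [mu] decays like [rate ^ n]. *)

(** * Arithmetic of the complex modulus *)

Section Modulus.
Variable R : realType.
Implicit Types x y z : R[i].

Lemma cabs_ge0 z : 0 <= cabs z :> R.
Proof. by case: z => x y; exact: sqrtr_ge0. Qed.

Lemma cabs_gt0 z : z != 0 -> 0 < cabs z :> R.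
Proof.
move=> z0; rewrite lt_def cabs_ge0 andbT.
by apply: contra z0 => /eqP/ComplexField.Normc.eq0_normc ->.
Qed.

Lemma cabsV z : cabs z^-1 = (cabs z)^-1 :> R.
Proof. exact: ComplexField.Normc.normcV. Qed.

Lemma cabs1 : cabs (1 : R[i]) = 1 :> R.
Proof. exact: ComplexField.Normc.normc1. Qed.

Lemma cabs0 : cabs (0 : R[i]) = 0 :> R.
Proof. exact: ComplexField.Normc.normc0. Qed.

Lemma cabsN z : cabs (- z) = cabs z :> R.
Proof. exact: normcN. Qed.

Lemma cabsD x y : cabs (x + y) <= cabs x + cabs y :> R.
Proof. exact: le_normcD. Qed.

Lemma cabsB x y : cabs (x - y) <= cabs x + cabs y :> R.
Proof. by rewrite -(cabsN y); exact: cabsD. Qed.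

Lemma cabs_real (r : R) : 0 <= r -> cabs r%:C = r :> R.
Proof. by move=> r0; rewrite /= expr0n addr0 sqrtr_sqr ger0_norm. Qed.

Lemma cabs_sqr z : cabs z ^+ 2 = complex.Re z ^+ 2 + complex.Im z ^+ 2 :> R.
Proof. by case: z => x y; rewrite sqr_sqrtr// addr_ge0 ?sqr_ge0. Qed.

Lemma Re_le_cabs z : `|complex.Re z| <= cabs z :> R.
Proof.
by rewrite -ler_sqr ?nnegrE ?cabs_ge0// cabs_sqr real_normK ?num_real// lerDl sqr_ge0.
Qed.

Lemma Im_le_cabs z : `|complex.Im z| <= cabs z :> R.
Proof.
by rewrite -ler_sqr ?nnegrE ?cabs_ge0// cabs_sqr real_normK ?num_real// lerDr sqr_ge0.
Qed.

End Modulus.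

(** * Continuity of complex-valued functions *)

Section ComplexContinuity.
Variables (R : realType) (T : topologicalType).
Implicit Types f g : T -> R[i].

(** Stated by coordinates because the compact space used below is a product of real intervals, one
    for each real and each imaginary part. *)
Definition ccontinuous f :=
  continuous (fun x => complex.Re (f x) : R) /\
  continuous (fun x => complex.Im (f x) : R).

Lemma ccontinuous_cst (k : R[i]) : ccontinuous (fun=> k).
Proof. by split=> x; exact: cvg_cst. Qed.

Lemma ccontinuousD f g : ccontinuous f -> ccontinuous g ->
  ccontinuous (fun x => f x + g x).
Proof.
move=> [fR fI] [gR gI]; split=> x; under eq_fun do rewrite raddfD/=.
  exact: cvgD (fR x) (gR x).
exact: cvgD (fI x) (gI x).
Qed.

Lemma ccontinuousM f g : ccontinuous f -> ccontinuous g ->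
  ccontinuous (fun x => f x * g x).
Proof.
move=> [fR fI] [gR gI].
have ReM (u v : R[i]) : complex.Re (u * v) =
    complex.Re u * complex.Re v - complex.Im u * complex.Im v by case: u v => ? ? [].
have ImM (u v : R[i]) : complex.Im (u * v) =
    complex.Re u * complex.Im v + complex.Im u * complex.Re v by case: u v => ? ? [].
split=> x.
  under eq_fun do rewrite ReM.
  exact: cvgB (cvgM (fR x) (gR x)) (cvgM (fI x) (gI x)).
under eq_fun do rewrite ImM.
exact: cvgD (cvgM (fR x) (gI x)) (cvgM (fI x) (gR x)).
Qed.

Lemma ccontinuous_cabs_sqr f : ccontinuous f ->
  continuous (fun x => cabs (f x) ^+ 2 : R).
Proof.
move=> [fR fI] x; under eq_fun do rewrite cabs_sqr.
exact: cvgD (cvgM (fR x) (fR x)) (cvgM (fI x) (fI x)).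
Qed.

End ComplexContinuity.

(** * Bi-infinite orbits by compactness *)

Lemma cluster_le (R : realType) (T : topologicalType) (x : nat -> T) (p : T)
  (h : T -> R) (M : R) :
  cluster (x @ \oo) p -> continuous h -> (\forall n \near \oo, h (x n) <= M) ->
  h p <= M.
Proof.
rewrite clusterE => cp ch hM.
have cl : closed (h @^-1` [set y | y <= M]).
  by apply: (preimage_closed _ (@closed_le R M)) => y _; exact: ch.
exact: cl p (cp (h @^-1` [set y | y <= M]) hM).
Qed.

Lemma cabs_le_sqr (R : realType) (z : R[i]) (r : R) :
  0 <= r -> (cabs z ^+ 2 <= r ^+ 2) = (cabs z <= r).
Proof. by move=> r0; rewrite ler_sqr ?nnegrE ?cabs_ge0. Qed.

(** The [n]-th approximation starts from [0] at time [- n] and runs forward. A cluster point of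
    these is an orbit, since each relation is a closed condition on finitely many coordinates that
    holds for all large [n]. *)
Lemma invariant_orbit (R : realType) (a b c d : int -> R[i]) (rho : R) :
  0 <= rho ->
  (forall j z, cabs z <= rho -> a j + b j * z != 0 /\
     cabs (c j + d j * z) <= rho * cabs (a j + b j * z)) ->
  exists z : int -> R[i], forall j, cabs (z j) <= rho /\
     c j + d j * z j = (a j + b j * z j) * z (j + 1).
Proof.
move=> rho0 H.
pose f j z := (c j + d j * z) / (a j + b j * z).
have fle j z : cabs z <= rho -> cabs (f j z) <= rho.
  move=> /(H j)[n0 le]; rewrite cabsM cabsV ler_pdivrMr//; exact: cabs_gt0.
pose w (n : nat) := fix w (k : nat) : R[i] :=
  if k is k'.+1 then f (k'%:Z - n%:Z) (w k') else 0.
have wle n k : cabs (w n k) <= rho.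
  by elim: k => [|k /fle]//=; rewrite expr0n addr0 sqrtr0.
(* The orbit reindexed by time. Before time [- n] the value is meaningless, but [wle] still bounds
   it by [rho]. *)
pose g n j := w n (absz (j + n%:Z)%R).
have gS n j : 0 <= j + n%:Z -> c j + d j * g n j = (a j + b j * g n j) * g n (j + 1).
  move=> jn0; rewrite /g -addrA (addrC 1) addrA.
  case jk: (j + n%:Z) jn0 => [k|//] _.
  have jE : k%:Z - n%:Z = j by rewrite -jk addrK.
  rewrite -[absz (k%:Z + 1)]/(k + 1)%N addn1 [w n k.+1]/= jE.
  by rewrite /f [RHS]mulrC divfK//; have [] := H j _ (wle n k).
pose X := prod_topology (fun _ : int * bool => R : topologicalType).
pose Z (p : X) j := (p (j, true) +i* p (j, false)).
pose x n : X :=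
  fun i => if i.2 then complex.Re (g n i.1) else complex.Im (g n i.1).
have Zx n j : Z (x n) j = g n j by rewrite /Z /x /=; case: (g n j).
have xI n i : `[- rho, rho]%classic (x n i).
  rewrite /= in_itv /= -ler_norml /x.
  by case: i => j [] /=; apply: le_trans (wle n _); [exact: Re_le_cabs | exact: Im_le_cabs].
have xF : (x @ \oo) [set f : X | forall i, `[- rho, rho]%classic (f i)].
  by exists 0%N => // n _ i; exact: xI.
have [p [_ cp]] := @tychonoff _ (fun _ : int * bool => R : topologicalType)
  _ (fun _ => @segment_compact R (- rho) rho) (x @ \oo) _ xF.
have cZ j : ccontinuous (fun p : X => Z p j).
  split.
  exact: (@proj_continuous _ (fun _ : int * bool => R : topologicalType) (j, true)).
  exact: (@proj_continuous _ (fun _ : int * bool => R : topologicalType) (j, false)).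
exists (Z p) => j; split.
  rewrite -cabs_le_sqr//.
  apply: (cluster_le cp (ccontinuous_cabs_sqr (cZ j))).
  by apply: nearW => n; rewrite Zx cabs_le_sqr ?wle.
(* [cluster_le] passes only inequalities to the limit, so the relation becomes: the squared modulus
   of its defect is at most [0]. *)
apply/eqP; rewrite -subr_eq0; apply/eqP/ComplexField.Normc.eq0_normc/eqP.
rewrite -sqrf_eq0 eq_le sqr_ge0 andbT.
have cE : ccontinuous (fun p : X =>
  (c j + d j * Z p j) + (- 1) * ((a j + b j * Z p j) * Z p (j + 1))).
  have cL u v : ccontinuous (fun p : X => u + v * Z p j).
    exact: ccontinuousD (ccontinuous_cst _ u) (ccontinuousM (ccontinuous_cst _ v) (cZ j)).
  exact: ccontinuousD (cL _ _) (ccontinuousM (ccontinuous_cst _ _)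
           (ccontinuousM (cL _ _) (cZ (j + 1)))).
rewrite -mulN1r; apply: (cluster_le cp (ccontinuous_cabs_sqr cE)).
(* From this index on, time [j] does not precede the start [- n]. *)
exists `|j|%N => // n /= jn.
rewrite !Zx gS ?mulN1r ?subrr ?cabs0 ?expr0n//.
lia.
Qed.

(** * Cones in the invariant frame and their contraction *)

Section Cone.
Variables (R : realType) (alpha beta : R).

(* [t] parametrizes the line of [(1, z) + t (-q, 1)], whose slope
   [(z + t) / (1 - t q)] is required to have modulus less than [r]. *)
Definition cone (r : R) (z q t : R[i]) := cabs (z + t) < r * cabs (1 - t * q).

(** As [alpha * cabs q <= 1], the parameter [t] shifts [cabs (z + t)] and [alpha * cabs (1 - t * q)]
    by at most [cabs t] each; the two shifts share the gap [alpha - beta], hence the half. *)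
Lemma cone_small (z q t : R[i]) : 0 < beta -> beta < alpha ->
  cabs z <= beta -> alpha * cabs q <= 1 -> cabs t < (alpha - beta) / 2 ->
  cone alpha z q t.
Proof.
move=> beta_gt0 beta_lt zb qa tr; rewrite /cone; apply: le_lt_trans (cabsD _ _) _.
have : 1 <= cabs (1 - t * q) + cabs t * cabs q :> R.
  by rewrite -cabsM -{1}(cabs1 R) -{1}(subrK (t * q) 1) cabsD.
have a0 : 0 < alpha by exact: lt_trans beta_lt.
have := cabs_ge0 t; move: (cabs t) (cabs q) (cabs (1 - _)) qa tr => T Q D qa tr T0 D1.
have : T * (alpha * Q) <= T * 1 by rewrite ler_wpM2l.
have : alpha * 1 <= alpha * (D + T * Q) by rewrite ler_pM2l.
by lra.
Qed.

(** As [cabs q <= 1 / alpha], the right side of the cone inequality grows at most like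
    [beta / alpha * cabs t], and the left side like [cabs t]. *)
Lemma cone_bounded (z q t : R[i]) : 0 < beta -> beta < alpha ->
  cabs z <= beta -> alpha * cabs q <= 1 -> cone beta z q t ->
  (alpha - beta) * cabs t < 2 * alpha * beta.
Proof.
move=> beta_gt0 beta_lt zb qa; rewrite /cone => ct.
have t1 : cabs t <= cabs (z + t) + cabs z :> R by rewrite -{1}(addrC t z) -{1}(addrK z t) cabsB.
have : cabs (1 - t * q) <= 1 + cabs t * cabs q :> R by rewrite -cabsM -(cabs1 R) cabsB.
have := cabs_ge0 t.
have a0 : 0 < alpha by exact: lt_trans beta_lt.
move: (cabs t) (cabs q) (cabs (1 - _)) qa t1 ct => T Q D qa t1 ct T0 D1.
have aT : alpha * T < alpha * (beta * D + beta) by rewrite ltr_pM2l//; lra.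
have TQ : beta * (T * (alpha * Q)) <= beta * (T * 1) by rewrite ler_pM2l// ler_wpM2l.
have : alpha * beta * D <= alpha * beta * (1 + T * Q) by rewrite ler_pM2l// mulr_gt0.
by lra.
Qed.

(** Chosen so that in [cone_widen] three times the displacement [(1 - rate) * cabs t] stays below
    [(alpha - beta) * cabs (1 - s * q)]. The [24] is this [3] times the [8] of [T2]. *)
Definition rate : R := 1 - (alpha - beta) ^+ 3 / (24 * alpha ^+ 3).

Lemma rate_bounds : 0 < beta -> beta < alpha -> 0 < rate < 1.
Proof.
move=> beta_gt0 beta_lt.
have a0 : 0 < alpha by exact: lt_trans beta_lt.
have a3 : 0 < 24 * alpha ^+ 3 by rewrite mulr_gt0// exprn_gt0.
have : (alpha - beta) ^+ 3 / (24 * alpha ^+ 3) < 1.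
  rewrite ltr_pdivrMr// mul1r.
  have : (alpha - beta) ^+ 3 <= alpha ^+ 3 by rewrite lerXn2r ?nnegrE //; lra.
  by have : 0 < alpha ^+ 3 by [rewrite exprn_gt0]; lra.
have : 0 < (alpha - beta) ^+ 3 / (24 * alpha ^+ 3).
  by rewrite divr_gt0// exprn_gt0//; lra.
by rewrite /rate; lra.
Qed.

(** Undoing the factor [rate] moves the numerator of the slope, and [alpha] times its denominator,
    by at most [(1 - rate) * cabs t]. The gap between [beta] and [alpha] absorbs both, once the
    denominator is bounded below. *)
Lemma cone_widen (z q t : R[i]) : 0 < beta -> beta < alpha ->
  cabs z <= beta -> alpha * cabs q <= 1 -> cone beta z q (rate%:C * t) ->
  cone alpha z q t.
Proof.
move=> beta_gt0 beta_lt zb qa ct; have a0 : 0 < alpha by exact: lt_trans beta_lt.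
have /andP[k0 k1] := rate_bounds beta_gt0 beta_lt.
have := cone_bounded beta_gt0 beta_lt zb qa ct.
rewrite cabsM cabs_real ?(ltW k0)// => tb.
move: ct; rewrite /cone; set s := rate%:C * t => ct.
have e0 : 0 <= 1 - rate by lra.
have ts : cabs (t - s) = (1 - rate) * cabs t :> R.
  have -> : t - s = (1 - rate)%:C * t by rewrite rmorphB rmorph1 mulrBl mul1r.
  by rewrite cabsM cabs_real.
have h1 : cabs (z + t) <= cabs (z + s) + cabs (t - s) :> R.
  by rewrite [z + t](_ : _ = (z + s) + (t - s)) ?cabsD//; ring.
have h2 : cabs (1 - s * q) <= cabs (1 - t * q) + cabs (t - s) * cabs q :> R.
  rewrite -cabsM [1 - s * q](_ : _ = (1 - t * q) + (t - s) * q) ?cabsD//; ring.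
(* [1 + z q = (1 - s q) + q (z + s)] keeps [1 - s q] away from zero. *)
have h3 : 1 <= cabs (1 - s * q) + cabs q * cabs (z + s) + cabs z * cabs q :> R.
  rewrite -!cabsM -{1}(cabs1 R).
  rewrite [X in cabs X <= _](_ : 1 = ((1 - s * q) + q * (z + s)) - z * q); last by ring.
  by apply: le_trans (cabsB _ _) _; rewrite lerD2r cabsD.
move: (cabs_ge0 t) (cabs_ge0 (z + s)) (cabs_ge0 z) (cabs_ge0 q); rewrite ts in h1 h2.
move: (cabs t) (cabs q) (cabs z) (cabs (z + s)) (cabs (1 - s * q)) (cabs (z + t))
  (cabs (1 - t * q)) qa zb ct tb h1 h2 h3.
move=> T Q Z S D S' D' qa zb ct tb h1 h2 h3 T0 S0 Z0 Q0 {ts s}.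
have D0 : (alpha - beta) <= (alpha + beta) * D.
  have : alpha * Q * S <= S by rewrite -{2}(mul1r S) ler_wpM2r.
  have : alpha * Q * Z <= Z by rewrite -{2}(mul1r Z) ler_wpM2r.
  have : alpha * 1 <= alpha * (D + Q * S + Z * Q) by rewrite ler_pM2l.
  by lra.
set e := 1 - rate in e0 h1 h2.
have eE : 24 * alpha ^+ 3 * e = (alpha - beta) ^+ 3.
  rewrite /e /rate; field; exact: lt0r_neq0.
have ab : 0 < alpha - beta by lra.
have eT : 3 * e * T * (alpha + beta) < (alpha - beta) ^+ 2.
  have a3 : 0 < alpha ^+ 3 by rewrite exprn_gt0.
  (* Turns the bound on [rate * T] into one on [T]. *)
  have r2 : 1 <= 2 * rate.
    have : (alpha - beta) ^+ 3 <= alpha ^+ 3 by rewrite lerXn2r ?nnegrE //; lra.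
    rewrite -eE => le1; have : 24 * e <= 1.
      by rewrite -(ler_pM2l a3) mulr1; lra.
    by rewrite /e; lra.
  have T1 : (alpha - beta) * T < 4 * alpha * beta.
    have : (alpha - beta) * T * 1 <= (alpha - beta) * T * (2 * rate).
      by rewrite ler_wpM2l// mulr_ge0// ltW.
    by lra.
  have T2 : (alpha - beta) * T * (alpha + beta) < 8 * alpha ^+ 3.
    have ab' : 0 < alpha + beta by lra.
    have : (alpha - beta) * T * (alpha + beta) < 4 * alpha * beta * (alpha + beta).
      by rewrite ltr_pM2r.
    have : beta * (alpha + beta) <= alpha * (alpha + alpha) by rewrite ler_pM //; lra.
    rewrite -(ler_pM2l a0); lra.
  have a24 : 0 < 24 * alpha ^+ 3 by lra.
  have ab2 : 0 < 3 * (alpha - beta) ^+ 2 by rewrite mulr_gt0// exprn_gt0.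
  rewrite -(ltr_pM2l a24).
  have -> : 24 * alpha ^+ 3 * (3 * e * T * (alpha + beta)) =
    3 * (alpha - beta) ^+ 2 * ((alpha - beta) * T * (alpha + beta)).
    by transitivity (24 * alpha ^+ 3 * e * (3 * T * (alpha + beta))); [ring | rewrite eE; ring].
  by rewrite -(ltr_pM2l ab2) in T2; apply: lt_le_trans T2 _; lra.
have eQ : alpha * (e * T * Q) <= e * T.
  by rewrite mulrCA -{2}(mulr1 (e * T)) ler_wpM2l ?mulr_ge0.
have h2' : alpha * D <= alpha * (D' + e * T * Q) by rewrite ler_pM2l.
have : 3 * e * T < (alpha - beta) * D.
  have ab' : 0 < alpha + beta by lra.
  rewrite -(ltr_pM2r ab'); apply: lt_le_trans eT _.
  by rewrite expr2 -!mulrA ler_pM2l// mulrC.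
have : 0 <= e * T by rewrite mulr_ge0.
by lra.
Qed.

(** By induction the cone at time [n] contains the disk of radius
    [(alpha - beta) / 2 * L n / rate ^+ n]: each step multiplies by [rho n], and [cone_widen] allows
    a division by [rate]. Boundedness of the [beta] cones caps this radius. *)
Lemma cone_contract (z q rho : nat -> R[i]) : 0 < beta -> beta < alpha ->
  (forall n, cabs (z n) <= beta) -> (forall n, alpha * cabs (q n) <= 1) ->
  (forall n t, cone alpha (z n) (q n) t ->
     cone beta (z n.+1) (q n.+1) (rho n * t)) ->
  forall n, rate * (alpha - beta) ^+ 2 * cabs (\prod_(k < n) rho k) <=
    5 * alpha ^+ 2 * rate ^+ n.
Proof.
move=> beta_gt0 beta_lt zb qa step n; have /andP[k0 k1] := rate_bounds beta_gt0 beta_lt.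
have a0 : 0 < alpha by exact: lt_trans beta_lt.
have ab : 0 < alpha - beta by lra.
have kC : rate%:C != 0 :> R[i] by rewrite fmorph_eq0 gt_eqF.
pose L m := cabs (\prod_(k < m) rho k).
have LS m : L m.+1 = L m * cabs (rho m) by rewrite /L big_ord_recr cabsM.
suff: (forall t, cabs t * rate ^+ n < (alpha - beta) / 2 * L n ->
         cone alpha (z n) (q n) t) /\
      rate * (alpha - beta) ^+ 2 * L n <= 5 * alpha ^+ 2 * rate ^+ n by case.
elim: n => [|n [IH _]].
  split=> [t|].
    by rewrite /L big_ord0 cabs1 expr0 !mulr1; exact: cone_small.
  rewrite /L big_ord0 cabs1 expr0 !mulr1.
  have : rate * (alpha - beta) ^+ 2 <= 1 * alpha ^+ 2.
    by apply: ler_pM; rewrite ?sqr_ge0// ?lerXn2r ?nnegrE //; lra.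
  by have : 0 < alpha ^+ 2 by [rewrite exprn_gt0]; lra.
have Hs t : cabs t * rate ^+ n < (alpha - beta) / 2 * L n.+1 ->
    cone beta (z n.+1) (q n.+1) t.
  (* A zero multiplier would make the disk empty, so dividing by [rho n] is legitimate. *)
  rewrite LS => lt; have r0 : rho n != 0.
    apply: contraTneq lt => ->; rewrite cabs0 !mulr0 -leNgt mulr_ge0 ?cabs_ge0//.
    by rewrite exprn_ge0 ?ltW.
  rewrite [t](_ : _ = rho n * (t / rho n)); last by rewrite mulrC divfK.
  apply/step/IH; rewrite cabsM cabsV -(ltr_pM2r (cabs_gt0 r0)).
  rewrite mulrAC divfK ?lt0r_neq0 ?cabs_gt0//; lra.
split=> [t lt|].
  apply: cone_widen => //; apply: Hs.
  by rewrite cabsM cabs_real ?(ltW k0)// -mulrA mulrCA -exprS.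
rewrite leNgt; apply/negP => lt.
(* [M] is the radius excluded by [cone_bounded]; if the estimate failed, the real point [M] would
   lie in the [beta] cone. The constant [5] exceeds the [4] of [4 * alpha * beta], and the leading
   [rate] appears because [Hs] precedes the last dilation. *)
pose M : R := 2 * alpha * beta / (alpha - beta).
have M0 : 0 <= M by rewrite /M divr_ge0 ?mulr_ge0// ltW.
have ME : (alpha - beta) * M = 2 * alpha * beta by rewrite mulrC divfK// gt_eqF.
have kn : 0 < rate ^+ n by rewrite exprn_gt0.
have lt' : 5 * alpha ^+ 2 * rate ^+ n < (alpha - beta) ^+ 2 * L n.+1.
  by rewrite -(ltr_pM2l k0); move: lt; rewrite [rate ^+ _.+1]exprS; lra.
have : cone beta (z n.+1) (q n.+1) M%:C.
  apply: Hs; rewrite cabs_real// -(ltr_pM2l ab) mulrA ME.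
  have : alpha * beta * rate ^+ n <= alpha ^+ 2 * rate ^+ n.
    by rewrite ler_pM2r// expr2 ler_pM2l// ltW.
  have : 0 < alpha ^+ 2 * rate ^+ n by rewrite mulr_gt0// exprn_gt0.
  lra.
by move=> /(cone_bounded beta_gt0 beta_lt (zb _) (qa _)); rewrite cabs_real// ME ltxx.
Qed.

End Cone.

(** In the invariant frames the matrix sends coordinates [(1, t)] to [(mu, nu * t)] with
    [mu = a + b * z] and [nu = d - c * q]. The disk hypothesis is applied to the slope
    [(z + t) / (1 - t * q)] and the factor [1 - t * q] is cleared. *)
Lemma cone_map (R : realType) (alpha beta : R) (a b c d z q z' q' t : R[i]) :
  (forall w, cabs w < alpha -> a + b * w != 0 /\
     cabs (c + d * w) < beta * cabs (a + b * w)) ->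
  a + b * z != 0 ->
  c + d * z = (a + b * z) * z' -> b + d * q' = (a + c * q') * q ->
  cone alpha z q t -> cone beta z' q' ((d - c * q) / (a + b * z) * t).
Proof.
rewrite /cone => H m0 Ez Eq ct.
have n0 : 1 - t * q != 0.
  by apply: contraTneq ct => ->; rewrite cabs0 mulr0 -leNgt cabs_ge0.
have ng0 := cabs_gt0 n0; have mg0 := cabs_gt0 m0.
have [|w0 wlt] := H ((z + t) / (1 - t * q)).
  by rewrite cabsM cabsV ltr_pdivrMr.
move: wlt; rewrite -(ltr_pM2r ng0) -[ltRHS]mulrA -!cabsM.
have -> : (c + d * ((z + t) / (1 - t * q))) * (1 - t * q) =
    (a + b * z) * (z' + (d - c * q) / (a + b * z) * t).
  by rewrite [RHS]mulrDr -Ez; field; apply/andP.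
have -> : (a + b * ((z + t) / (1 - t * q))) * (1 - t * q) =
    (a + b * z) * (1 - (d - c * q) / (a + b * z) * t * q').
  transitivity (a + b * z - t * (a * q - b)); first by field.
  have -> : a * q - b = (d - c * q) * q' by rewrite (_ : b = (a + c * q') * q - d * q'); [ring | rewrite -Eq; ring].
  by field.
by rewrite !cabsM mulrCA ltr_pM2l.
Qed.

(** * Estimates for a matrix mapping one disk into another *)

Section DiskMap.
Variables (R : realType) (alpha beta : R) (a b c d : R[i]).

Definition maps_disk := forall w : R[i], cabs w < alpha ->
  a + b * w != 0 /\ cabs (c + d * w) < beta * cabs (a + b * w).

Lemma maps_disk_neq0 : 0 < alpha -> maps_disk -> a != 0.
Proof. by move=> a0 /(_ 0); rewrite cabs0 mulr0 addr0 => /(_ a0)[]. Qed.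

(** Otherwise the pole [- a / b] would lie in the open disk. *)
Lemma maps_disk_b : 0 < alpha -> maps_disk -> alpha * cabs b <= cabs a.
Proof.
move=> a0 H; rewrite leNgt; apply/negP => lt.
have b0 : b != 0.
  by apply: contraTneq lt => ->; rewrite cabs0 mulr0 -leNgt cabs_ge0.
have [|+ _] := H (- a / b).
  by rewrite cabsM cabsN cabsV ltr_pdivrMr ?cabs_gt0.
by rewrite mulrC divfK// subrr eqxx.
Qed.

Lemma maps_disk_c : 0 < alpha -> maps_disk -> cabs c <= beta * cabs a.
Proof. by move=> a0 /(_ 0); rewrite cabs0 !mulr0 !addr0 => /(_ a0)[_ /ltW]. Qed.

(** Evaluation at [w = beta], combined with the bounds on [b] and [c]. *)
Lemma maps_disk_d : 0 < beta -> beta < alpha -> maps_disk -> cabs d <= 3 * cabs a.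
Proof.
move=> b0 ba H; have a0 : 0 < alpha by exact: lt_trans ba.
have bC : cabs beta%:C = beta :> R by rewrite cabs_real// ltW.
have [|_ lt] := H beta%:C; first by rewrite bC.
have cle := maps_disk_c a0 H; have ble := maps_disk_b a0 H.
have : cabs (d * beta%:C) <= cabs (c + d * beta%:C) + cabs c :> R.
  by rewrite -{1}(addrK c (d * _)) (addrC (d * _)) cabsB.
have : cabs (a + b * beta%:C) <= cabs a + cabs (b * beta%:C) :> R by exact: cabsD.
rewrite !cabsM bC => h1 h2; rewrite -(ler_pM2l b0).
have : cabs b * beta <= cabs a.
  by apply: le_trans ble; rewrite mulrC ler_wpM2r ?cabs_ge0// ltW.
by move: h1; rewrite -(ler_pM2l b0); nra.
Qed.

(** Keeps the unstable multiplier away from zero: [b * z] has modulus at most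
    [beta / alpha * cabs a]. *)
Lemma maps_disk_slope (z : R[i]) : 0 < alpha -> maps_disk -> cabs z <= beta ->
  (alpha - beta) * cabs a <= alpha * cabs (a + b * z).
Proof.
move=> a0 H zb; have := maps_disk_b a0 H.
have h : cabs a <= cabs (a + b * z) + cabs b * cabs z :> R.
  by rewrite -cabsM -{1}(addrK (b * z) a) cabsB.
have := cabs_ge0 z; have := cabs_ge0 b; move: zb h.
move: (cabs a) (cabs b) (cabs (a + b * z)) (cabs z) => A B M Z zb h1 B0 Z0 h2.
have : alpha * B * Z <= A * beta by rewrite ler_pM// mulr_ge0// ltW.
move: h1; rewrite -(ler_pM2l a0); lra.
Qed.

(** The pairing [(a + c * q) + (b + d * q) * w] equals [(a + b * w) + q * (c + d * w)], which cannot
    vanish for [cabs w < alpha] because [beta * cabs q < 1]. Its value at [0] and the position of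
    its root give the two claims. *)
Lemma maps_disk_dual (q : R[i]) : 0 < beta -> beta < alpha -> maps_disk ->
  cabs q <= alpha^-1 ->
  a + c * q != 0 /\ cabs (b + d * q) <= alpha^-1 * cabs (a + c * q).
Proof.
move=> b0 ba H qa; have a0 : 0 < alpha by exact: lt_trans ba.
have key w : cabs w < alpha -> (a + c * q) + (b + d * q) * w != 0.
  move=> /H[w0 lt]; apply/eqP => E.
  have : a + b * w = - (q * (c + d * w)).
    by apply/eqP; rewrite -subr_eq0 opprK -E; apply/eqP; ring.
  move=> /(congr1 (fun v => cabs v : R)); rewrite cabsN cabsM => F.
  have M0 := cabs_gt0 w0; move: (lt) M0; rewrite F.
  move: (cabs_ge0 (c + d * w)) (cabs_ge0 q) lt; rewrite F.
  have qa1 : alpha * cabs q <= 1 by rewrite -(divff (lt0r_neq0 a0)) ler_pM2l.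
  move: (cabs _) (cabs q) qa1 => S Q qa1 S0 Q0 lt _ _.
  have : beta * Q <= alpha * Q by rewrite ler_wpM2r// ltW.
  have := mulr_ge0 S0 Q0.
  nra.
split; first by have := key 0; rewrite cabs0 mulr0 addr0; exact.
rewrite -(ler_pM2l a0) mulrA divff ?mul1r ?gt_eqF// leNgt; apply/negP => lt.
have n0 : b + d * q != 0.
  by apply: contraTneq lt => ->; rewrite cabs0 mulr0 -leNgt cabs_ge0.
have := key (- (a + c * q) / (b + d * q)).
rewrite cabsM cabsN cabsV ltr_pdivrMr ?cabs_gt0// => /(_ lt).
by rewrite [(b + _) * _]mulrC divfK// subrr eqxx.
Qed.

End DiskMap.

(** * Vectors, operator norm and iterates *)

Section Vectors.
Variable R : realType.
Implicit Types (x y : R[i]) (v : 'cV[R[i]]_2) (A : 'M[R[i]]_2).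

Definition vec2 x y : 'cV[R[i]]_2 := \col_(i < 2) (if i == 0 then x else y).

Lemma vec2_eta v : v = vec2 (v 0 0) (v 1 0).
Proof.
apply/matrixP => i j; rewrite mxE (ord1 j).
by case: i => -[|[|//]] ?; congr (v _ _); apply: val_inj.
Qed.

Lemma mulmx_vec2 A x y :
  A *m vec2 x y = vec2 (A 0 0 * x + A 0 1 * y) (A 1 0 * x + A 1 1 * y).
Proof.
apply/matrixP => i k; rewrite !mxE big_ord_recl big_ord1 !mxE /=.
have -> : lift ord0 ord0 = 1 :> 'I_2 by apply: val_inj.
by case: i => -[|[|//]] ?; congr (A _ _ * _ + A _ _ * _); apply: val_inj.
Qed.

Lemma scale_vec2 k x y : k *: vec2 x y = vec2 (k * x) (k * y).
Proof. by apply/matrixP => i j; rewrite !mxE; case: ifP. Qed.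

Lemma vnorm_vec2_sqr x y : vnorm (vec2 x y) ^+ 2 = cabs x ^+ 2 + cabs y ^+ 2.
Proof.
rewrite /vnorm big_ord_recl big_ord1 !mxE /= sqr_sqrtr// addr_ge0 ?sqr_ge0//.
Qed.

Lemma vnorm_ge0 v : 0 <= vnorm v.
Proof. exact: sqrtr_ge0. Qed.

Lemma cabs_le_vnorm1 x y : cabs x <= vnorm (vec2 x y).
Proof.
by rewrite -ler_sqr ?nnegrE ?cabs_ge0 ?vnorm_ge0// vnorm_vec2_sqr lerDl sqr_ge0.
Qed.

Lemma cabs_le_vnorm2 x y : cabs y <= vnorm (vec2 x y).
Proof.
by rewrite -ler_sqr ?nnegrE ?cabs_ge0 ?vnorm_ge0// vnorm_vec2_sqr lerDr sqr_ge0.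
Qed.

Lemma vnorm_vec2_le x y : vnorm (vec2 x y) <= cabs x + cabs y.
Proof.
rewrite -ler_sqr ?nnegrE ?addr_ge0 ?cabs_ge0 ?vnorm_ge0// vnorm_vec2_sqr sqrrD.
by rewrite -addrA [_ *+ 2 + _]addrC addrA lerDl mulrn_wge0// mulr_ge0 ?cabs_ge0.
Qed.

(** A crude majorant of [opnorm]: it shows that the [sup] is over a bounded set, and later converts
    a lower bound on [opnorm] into one on the top left entry. *)
Definition entry_sum A : R :=
  cabs (A 0 0) + cabs (A 0 1) + (cabs (A 1 0) + cabs (A 1 1)).

Lemma vnorm_mulmx_le A v : vnorm v = 1 -> vnorm (A *m v) <= entry_sum A.
Proof.
rewrite (vec2_eta v) mulmx_vec2; set x := v 0 0; set y := v 1 0 => v1.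
have x1 : cabs x <= 1 by rewrite -v1 cabs_le_vnorm1.
have y1 : cabs y <= 1 by rewrite -v1 cabs_le_vnorm2.
apply: le_trans (vnorm_vec2_le _ _) _; rewrite /entry_sum.
by apply: lerD; apply: le_trans (cabsD _ _) _; rewrite !cabsM;
  apply: lerD; rewrite ler_piMr ?cabs_ge0.
Qed.

Lemma vnorm_e1 : vnorm (vec2 1 0 : 'cV[R[i]]_2) = 1.
Proof.
apply/eqP; rewrite -(@eqrXn2 _ 2) ?vnorm_ge0// vnorm_vec2_sqr cabs1 cabs0.
by rewrite expr0n addr0.
Qed.

Lemma opnorm_le A : opnorm A <= entry_sum A.
Proof.
apply: ge_sup; first by exists (vnorm (A *m vec2 1 0)), (vec2 1 0) => //; exact: vnorm_e1.
by move=> _ [v v1 <-]; exact: vnorm_mulmx_le.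
Qed.

Lemma vnorm_mulmx_opnorm A v : v != 0 -> vnorm (A *m v) <= opnorm A * vnorm v.
Proof.
move=> v0; have n0 : 0 < vnorm v.
  rewrite lt_def vnorm_ge0 andbT; apply: contra v0 => /eqP n0.
  rewrite (vec2_eta v) in n0 *.
  have x0 : v 0 0 = 0.
    by apply/ComplexField.Normc.eq0_normc/le_anti; rewrite cabs_ge0 -n0 cabs_le_vnorm1.
  have y0 : v 1 0 = 0.
    by apply/ComplexField.Normc.eq0_normc/le_anti; rewrite cabs_ge0 -n0 cabs_le_vnorm2.
  by rewrite x0 y0; apply/eqP/matrixP => i j; rewrite !mxE; case: ifP.
have nC : cabs (vnorm v)%:C = vnorm v by rewrite cabs_real ?vnorm_ge0.
have C0 : (vnorm v)%:C != 0 :> R[i] by rewrite fmorph_eq0 gt_eqF.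
rewrite -ler_pdivrMr//; apply: ub_le_sup.
  by exists (entry_sum A) => _ [w w1 <-]; exact: vnorm_mulmx_le.
exists ((vnorm v)%:C^-1 *: v).
  by rewrite /= vnormZ cabsV nC mulVf// gt_eqF.
by rewrite -scalemxAr vnormZ cabsV nC mulrC.
Qed.

Lemma opnorm_ge0 A : 0 <= opnorm A.
Proof.
have := @vnorm_mulmx_opnorm A (vec2 1 0).
rewrite vnorm_e1 mulr1 => /(_ _)/(le_trans (vnorm_ge0 _)); apply.
by apply/eqP => /matrixP/(_ 0 0)/eqP; rewrite !mxE /= oner_eq0.
Qed.

Lemma iter_mx_eigen (B : int -> 'M[R[i]]_2) (U : int -> 'cV[R[i]]_2)
  (m : int -> R[i]) : (forall j, B j *m U j = m j *: U (j + 1)) ->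
  forall n j, iter_mx B n j *m U j = (\prod_(k < n) m (j + k%:Z)) *: U (j + n%:Z).
Proof.
move=> H; elim=> [|n IH] j; first by rewrite mul1mx big_ord0 scale1r addr0.
rewrite /= -mulmxA IH -scalemxAr H scalerA big_ord_recr /=.
by rewrite -addrA -[n%:Z + 1]/((n + 1)%N%:Z) addn1.
Qed.

End Vectors.

(** * From invariant orbits to dominated splitting *)

Lemma geometric_lt (R : realType) (k C e : R) : 0 < k < 1 -> 0 < e ->
  exists2 N, (0 < N)%N & C * k ^+ N < e.
Proof.
move=> /andP[k0 k1] e0.
have : `|k| < 1 by rewrite ger0_norm// ltW.
move=> /(cvg_geometric C)/(cvgr_lt 0)/(_ _ e0)[n _ H].
by exists n.+1 => //; exact: (H n.+1 (leqnSn n)).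
Qed.

Lemma proj_sub_maps_disk (R : realType) (alpha beta : R) (A : 'M[R[i]]_2) :
  proj_sub A (disk alpha) (disk beta) ->
  maps_disk alpha beta (A 0 0) (A 0 1) (A 1 0) (A 1 1).
Proof.
move=> H w wa; have [|_ [v vb <-]] := H (Some w); first by exists w.
move=> /proj_actE[n0 vE]; split=> //.
by move: vb; rewrite /= vE cabsM cabsV ltr_pdivrMr ?cabs_gt0.
Qed.

Section Splitting.
Variables (R : realType) (alpha beta : R) (A : int -> 'M[R[i]]_2).
Variables (z q : int -> R[i]).

Let U j := vec2 1 (z j).
Let S j := vec2 (- q j) 1.
Let mu j := A j 0 0 + A j 0 1 * z j.
Let nu j := A j 1 1 - A j 1 0 * q j.

(** The relations on [z] and [q] make the lines of [U] and [S] invariant. These vectors have norms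
    between [1] and a constant, so domination reduces to comparing products of [mu] and [nu]. *)
Lemma splitting_of_orbits (eps : R) :
  0 < beta -> beta < alpha -> 0 < eps ->
  (forall j, maps_disk alpha beta (A j 0 0) (A j 0 1) (A j 1 0) (A j 1 1)) ->
  (forall j, eps <= opnorm (A j)) ->
  (forall j, cabs (z j) <= beta) -> (forall j, cabs (q j) <= alpha^-1) ->
  (forall j, A j 1 0 + A j 1 1 * z j = mu j * z (j + 1)) ->
  (forall j, A j 0 1 + A j 1 1 * q (j + 1) = (A j 0 0 + A j 1 0 * q (j + 1)) * q j) ->
  dominated_splitting A.
Proof.
move=> b0 ba eps0 H epsA zb qa zE qE; have a0 : 0 < alpha by exact: lt_trans ba.
have qa1 j : alpha * cabs (q j) <= 1.
  by rewrite -(divff (lt0r_neq0 a0)) ler_pM2l.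
have mu0 j : mu j != 0 by have [] := H j (z j) (le_lt_trans (zb j) ba).
have AU j : A j *m U j = mu j *: U (j + 1).
  by rewrite mulmx_vec2 scale_vec2 !mulr1 -zE.
have AS j : A j *m S j = nu j *: S (j + 1).
  rewrite mulmx_vec2 scale_vec2 !mulr1; congr (vec2 _ _); rewrite /nu; last by ring.
  rewrite (_ : A j 0 1 = (A j 0 0 + A j 1 0 * q (j + 1)) * q j - A j 1 1 * q (j + 1)).
    by ring.
  by rewrite -qE addrK.
have U1 j : 1 <= vnorm (U j) by rewrite -(cabs1 R) cabs_le_vnorm1.
have S1 j : 1 <= vnorm (S j) by rewrite -(cabs1 R) cabs_le_vnorm2.
have Ule j : vnorm (U j) <= 1 + beta.
  by apply: le_trans (vnorm_vec2_le _ _) _; rewrite cabs1 lerD2l.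
have Sle j : vnorm (S j) <= alpha^-1 + 1.
  by apply: le_trans (vnorm_vec2_le _ _) _; rewrite cabs1 cabsN lerD2r.
have Cu0 : 0 < 1 + beta by lra.
have Cs0 : 0 < alpha^-1 + 1 by rewrite addr_gt0 ?invr_gt0.
have Un0 j : U j != 0.
  by apply/eqP => /matrixP/(_ 0 0)/eqP; rewrite !mxE /= oner_eq0.
have Sn0 j : S j != 0.
  by apply/eqP => /matrixP/(_ 1 0)/eqP; rewrite !mxE /= oner_eq0.
have step j (k : nat) t : cone alpha (z (j + k%:Z)) (q (j + k%:Z)) t ->
    cone beta (z (j + k.+1%:Z)) (q (j + k.+1%:Z)) (nu (j + k%:Z) / mu (j + k%:Z) * t).
  by rewrite -addn1 PoszD addrA; exact: cone_map (H _) (mu0 _) (zE _) (qE _).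
(* The resulting bound depends only on [alpha] and [beta], so one [N] serves every starting time
   [j]. *)
have contract j := @cone_contract R alpha beta (fun k => z (j + k%:Z))
  (fun k => q (j + k%:Z)) (fun k => nu (j + k%:Z) / mu (j + k%:Z)) b0 ba
  (fun k => zb _) (fun k => qa1 _) (step j).
have ab : 0 < alpha - beta by lra.
have k01 := rate_bounds b0 ba; have /andP[k0 _] := k01.
have c0 : 0 < rate alpha beta * (alpha - beta) ^+ 2 by rewrite mulr_gt0// exprn_gt0.
(* The [2] is the future [lambda]; [1 + beta] and [alpha^-1 + 1] pay for the norms of [U] and
   [S]. *)
have [N N0 Nlt] := geometric_lt
  (2 * (1 + beta) * (alpha^-1 + 1) * (5 * alpha ^+ 2)) k01 c0.
pose MU j := \prod_(k < N) mu (j + k%:Z).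
pose NU j := \prod_(k < N) nu (j + k%:Z).
have MU0 j : 0 < cabs (MU j) by apply: cabs_gt0; apply/prodf_neq0 => k _; exact: mu0.
have dom j : 2 * (1 + beta) * (alpha^-1 + 1) * cabs (NU j) < cabs (MU j).
  have := contract j N; rewrite prodf_div -/(MU j) -/(NU j) cabsM cabsV mulrA.
  rewrite ler_pdivrMr// -(ltr_pM2l c0) => le1.
  have CC : 0 < 2 * (1 + beta) * (alpha^-1 + 1) by rewrite !mulr_gt0.
  move: le1; rewrite -(ler_pM2l CC) => le1.
  rewrite -(ltr_pM2r (MU0 j)) in Nlt.
  by apply: le_lt_trans Nlt; move: le1; rewrite -!mulrA; lra.
exists (fun j => <[U j]>%VS), (fun j => <[S j]>%VS); split.
- by move=> j; rewrite !dim_vline Un0 Sn0.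
- move=> j; rewrite !limg_line !lfunE /= -!memvE.
  by split; apply/vlineP; [exists (mu j); exact: AU | exists (nu j); exact: AS].
- exists N, 2; split=> //.
  + by rewrite ltr1n.
  + move=> j _ _ /vlineP[k ->] /vlineP[l ->].
    rewrite !vnormZ -!scalemxAr !vnormZ (iter_mx_eigen AU) (iter_mx_eigen AS) !vnormZ.
    rewrite -/(MU j) -/(NU j) => k1 l1.
    have l1' : cabs l <= 1 by rewrite -l1 ler_peMr ?cabs_ge0.
    have k1' : 1 <= (1 + beta) * cabs k by rewrite -{1}k1 [leRHS]mulrC ler_wpM2l ?cabs_ge0.
    apply: (@le_lt_trans _ _ (2 * (alpha^-1 + 1) * cabs (NU j))).
      rewrite -!mulrA ler_pM2l// mulrA [leRHS]mulrC -[cabs l * _]mulrC -mulrA.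
      rewrite ler_wpM2l ?cabs_ge0//; apply: le_trans (Sle (j + N%:Z)).
      by rewrite ler_piMl ?vnorm_ge0.
    rewrite -(ltr_pM2l Cu0).
    apply: (@lt_le_trans _ _ (cabs (MU j))); first by apply: le_lt_trans (dom j); lra.
    rewrite mulrA; apply: le_trans (ler_peMl (ltW (MU0 j)) k1') _.
    by rewrite -[leLHS]mulrA ler_pM2l// ler_peMr// mulr_ge0 ?cabs_ge0.
  + have ai0 : 0 < alpha^-1 by rewrite invr_gt0.
    (* The entries are bounded by [1], [alpha^-1], [beta] and [3] times the first one, whence
       [4 + beta + alpha^-1]; [maps_disk_slope] then passes from that entry to [mu j]. *)
    have mlow j : (alpha - beta) * eps <=
        alpha * (4 + beta + alpha^-1) * cabs (mu j).
      have := maps_disk_slope a0 (H j) (zb j).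
      have := maps_disk_b a0 (H j); have := maps_disk_c a0 (H j).
      have := maps_disk_d b0 ba (H j).
      have := le_trans (epsA j) (opnorm_le (A j)); rewrite /entry_sum -/(mu j).
      move: (cabs (A j 0 0)) (cabs (A j 0 1)) (cabs (A j 1 0)) (cabs (A j 1 1)) (cabs (mu j)).
      move=> a b c d m epsle dle cle ble mle.
      have ble' : b <= alpha^-1 * a by rewrite mulrC ler_pdivlMr// mulrC.
      have K0 : 0 < 4 + beta + alpha^-1 by lra.
      have : eps <= (4 + beta + alpha^-1) * a by lra.
      rewrite -(ler_pM2l ab) => /le_trans; apply.
      rewrite -(ler_pM2l K0) in mle; move: (alpha^-1) mle => ia; lra.
    pose m := (alpha - beta) * eps / (alpha * (4 + beta + alpha^-1)).
    have K0 : 0 < alpha * (4 + beta + alpha^-1) by rewrite mulr_gt0//; lra.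
    have m0 : 0 < m by rewrite divr_gt0// mulr_gt0.
    have mprod n j : m ^+ n <= cabs (\prod_(k < n) mu (j + k%:Z)).
      elim: n => [|n IH]; first by rewrite big_ord0 cabs1 expr0.
      rewrite big_ord_recr cabsM exprSr ler_pM ?exprn_ge0 ?(ltW m0)//.
      by rewrite ler_pdivrMr// [leRHS]mulrC.
    (* Testing the iterate on [U j] alone suffices: its image has norm at least [m ^+ N]. *)
    apply: (@lt_le_trans _ _ (m ^+ N / (1 + beta))); first by rewrite divr_gt0 ?exprn_gt0.
    apply: lb_le_inf; first by exists (opnorm (iter_mx A N 0)), 0.
    move=> _ [j _ <-]; rewrite ler_pdivrMr//; apply: le_trans (mprod N j) _.
    have := vnorm_mulmx_opnorm (iter_mx A N j) (Un0 j).
    rewrite (iter_mx_eigen AU) vnormZ -/(MU j) => le1.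
    apply: (@le_trans _ _ (cabs (MU j) * vnorm (U (j + N%:Z)))).
      by rewrite ler_peMr// ltW.
    by apply: le_trans le1 _; rewrite ler_wpM2l ?opnorm_ge0.
(* The determinant of the frame is [1 + z j * q j], with [cabs (z j * q j) <= beta / alpha]. The
   factor [2] of the distance makes the inequality strict. *)
- exists ((1 - beta / alpha) / ((1 + beta) * (alpha^-1 + 1))).
    by rewrite divr_gt0 ?mulr_gt0// subr_gt0 ltr_pdivrMr// mul1r.
  move=> j; rewrite (@line_distE _ _ _ (U j) (S j)) ?dim_vline ?Un0 ?Sn0 ?memv_line//.
  rewrite /vect_dist det2 !mxE /= !mulr1 mulrN opprK.
  have VV : 0 < vnorm (U j) * vnorm (S j) by rewrite mulr_gt0// (lt_le_trans ltr01).
  have zq : cabs (z j * q j) <= beta / alpha by rewrite cabsM ler_pM ?cabs_ge0.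
  have one : 1 - beta / alpha <= cabs (1 + z j * q j).
    by rewrite lerBlDr -{1}(cabs1 R) -{1}(addrK (z j * q j) 1) (le_trans (cabsB _ _))// lerD2l.
  have one0 : 0 < 1 - beta / alpha by rewrite subr_gt0 ltr_pdivrMr// mul1r.
  apply: (@le_lt_trans _ _ (cabs (1 + z j * q j) / (vnorm (U j) * vnorm (S j)))).
    rewrite ler_pM ?(ltW one0) ?invr_ge0 ?mulr_ge0 ?(ltW Cu0) ?(ltW Cs0)//.
    by rewrite lef_pV2 ?posrE ?VV ?(mulr_gt0 Cu0 Cs0)// ler_pM ?vnorm_ge0.
  by rewrite ltr_pM2r ?invr_gt0//; lra.
Qed.

End Splitting.

Theorem theorem6 (R : realType) (A : int -> 'M[R[i]]_2)
  (Abounded : has_ubound (range (fun j : int => opnorm (A j))))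
  (Ainf : 0 < inf (range (fun j : int => opnorm (A j))))
  (Adisk : exists alpha alpha' : R,
    [/\ alpha > alpha', alpha' > 0 &
        forall j : int, proj_sub (A j) (disk alpha) (disk alpha')]) :
  dominated_splitting A.
Proof.
have [alpha [beta [ba b0 AD]]] := Adisk.
have a0 : 0 < alpha by exact: lt_trans ba.
have H j := proj_sub_maps_disk (AD j).
have [z zP] := @invariant_orbit R (fun j => A j 0 0) (fun j => A j 0 1)
  (fun j => A j 1 0) (fun j => A j 1 1) beta (ltW b0)
  (fun j w wb => let: conj n0 lt := H j w (le_lt_trans wb ba) in conj n0 (ltW lt)).
(* Slopes of the stable lines: orbits of the transposed matrices in reversed time. *)
have ai : 0 <= alpha^-1 by rewrite invr_ge0 ltW.
have [q qP] := @invariant_orbit R (fun k => A (- k - 1) 0 0) (fun k => A (- k - 1) 1 0)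
  (fun k => A (- k - 1) 0 1) (fun k => A (- k - 1) 1 1) alpha^-1 ai
  (fun k w wa => maps_disk_dual b0 ba (H _) wa).
apply: (@splitting_of_orbits R alpha beta A z (fun j => q (- j)) _ b0 ba Ainf H) => j.
- apply: ge_inf; last by exists j.
  by exists 0 => _ [i _ <-]; exact: opnorm_ge0.
- by have [] := zP j.
- by have [] := qP (- j).
- by have [] := zP j.
(* At reversed time [k = - (j + 1)] the index [- k - 1] is [j], and the step goes from [q] at
   [j + 1] to [q] at [j]. *)
- have [_ /=] := qP (- (j + 1)).
  by rewrite opprK addrK opprD addrNK.
Qed.
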